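(* Let $(x,y,f,q,s,e)$ be a vector satisfying all the constraints (C1)--(C14) and the domain constraints (D) of the DOBC model listed in the context. If in addition $$\sum_{a\in\delta^+(S)}x_a\;\ge\; y_v+y_{v'}-1-\sum_{w\in S^c\cap U}s_w\qquad\text{for all } S\subset\widetilde V,\ v\in S\cap\widetilde P,\ v'\in S^c\cap\widetilde P,$$ where $S^c=\widetilde V\setminus S$, then the subnetwork defined by the solution, i.e. the directed graph with node set $\{v\in\widetilde V: y_v=1\}$ and arc set $\{a\in\widetilde A: x_a=1\}$, is (weakly) connected.
   Context: Data: a finite directed graph $G=(V,A)$ without loops; a set $P\subset V$ of pick-up points and a set $U\subset V$ of potential drop-off points with $P\cup U=V$, $P\cap U=\emptyset$; no arc of $A$ joins two points of $U$; demands $p_v\ge 0$ ($v\in P$); set-up costs $F_w$ ($w\in U$); budget $B$; vehicle capacity $\rho>0$; minimum amount $\eta>0$ to be received at each activated drop-off point; maximum numbers of visits $m_v\in\mathbb{Z}_{>0}$ ($v\in P$), with the convention $m_w=1$ for $w\in U$. Extended graph: $\widetilde G=(\widetilde V,\widetilde A)$ is obtained from $G$ by replacing each node $v\in V$ by $m_v$ copies (replicas), and each arc $(v,w)\in A$ by the $m_v\times m_w$ arcs from every copy of $v$ to every copy of $w$. $\widetilde P$ is the set of all copies of pick-up points, so $\widetilde V=\widetilde P\cup U$. The map $\pi$ sends each copy to its original node. For $S\subseteq\widetilde V$, $\delta^+(S)=\{(v,w)\in\widetilde A: v\in S,\ w\notin S\}$ and $\delta^-(S)=\{(v,w)\in\widetilde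 A: w\in S,\ v\notin S\}$. For a node $v$, $\delta^{\pm}(v)=\delta^{\pm}(\{v\})$ and $\delta(v)=\delta^+(v)\cup\delta^-(v)$. Variables and domains (D): $y_v\in\{0,1\}$ for $v\in\widetilde V$ (node is used); $x_a\in\{0,1\}$ for $a\in\widetilde A$ (arc is used); $f_a\ge 0$ for $a\in\widetilde A$ (flow on the arc); $q_v\in[0,1]$ for $v\in\widetilde P$ (proportion of the demand of $\pi(v)$ collected at this visit); $s_w,e_w\in\{0,1\}$ for $w\in U$ (starting, respectively ending, drop-off point of the walk). Constraints: (C1) $\sum_{w\in U}F_w y_w\le B$. (C2) $\sum_{a\in\delta(w)}x_a\le 2|\widetilde P|\,y_w$ for all $w\in U$. (C3) $\sum_{v'\in\widetilde P:\pi(v')=v}q_{v'}=1$ for all $v\in P$. (C4) $q_v\le y_v$ for all $v\in\widetilde P$. (C5) $\sum_{v'\in\widetilde P:\pi(v')=v}y_{v'}\ge 1$ for all $v\in P$. (C6) $\sum_{a\in\delta^+(v)}x_a=y_v$ for all $v\in\widetilde P$. (C7) $\sum_{a\in\delta^-(v)}x_a=y_v$ for all $v\in\widetilde P$. (C8) $\sum_{a\in\delta^+(v)}f_a-\sum_{a\in\delta^-(v)}f_a=q_v\,p_{\pi(v)}$ for all $v\in\widetilde P$. (C9) $f_a\le\rho\,x_a$ for all $a\in\widetilde A$. (C10) $\sum_{a\in\delta^-(w)}f_a\ge\eta\,y_w$ for all $w\in U$. (C11) $\sum_{a\in\delta^+(w)}x_a-\sum_{a\in\delta^-(w)}x_a=s_w-e_w$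 for all $w\in U$. (C12) $\sum_{w\in U}e_w\le 1$ and $\sum_{w\in U}s_w\le 1$. (C13) $\sum_{w\in U}e_w-\sum_{w\in U}s_w=0$. (C14) $e_w+s_w\le y_w$ for all $w\in U$. A directed graph is weakly connected if its underlying undirected graph is connected. *)

(* Defs.v *)
From HB Require Import structures.
From mathcomp Require Import all_boot all_order all_algebra.

Set Implicit Arguments.
Unset Strict Implicit.
Unset Printing Implicit Defensive.

Import Order.TTheory GRing.Theory Num.Theory.
Local Open Scope ring_scope.

(* The arcs of a graph are ordered pairs of nodes, so there are no parallel
   arcs.  Node parameters are total functions on V, constrained (and used) only
   on the part of V where they are meaningful. *)
Record dobc_data (R : realFieldType) (V : finType) := DobcData {
  arcs : {set V * V};
  pickup : {set V};
  dropoff : {set V};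
  demand : V -> R;
  setup_cost : V -> R;
  budget : R;
  capacity : R;
  min_amount : R;
  max_visits : V -> nat;
  arcs_loopless : forall v, (v, v) \notin arcs;
  pickupU_dropoff : pickup :|: dropoff = [set: V];
  pickupI_dropoff : pickup :&: dropoff = set0;
  arcs_no_dropoff2 : forall v w,
    v \in dropoff -> w \in dropoff -> (v, w) \notin arcs;
  demand_ge0 : forall v, v \in pickup -> 0 <= demand v;
  capacity_gt0 : 0 < capacity;
  min_amount_gt0 : 0 < min_amount;
  max_visits_pickup : forall v, v \in pickup -> (0 < max_visits v)%N;
  max_visits_dropoff : forall w, w \in dropoff -> max_visits w = 1%N
}.

Section ExtendedGraph.
Variables (R : realFieldType) (V : finType) (D : dobc_data R V).

Definition ext_node : finType := {v : V & 'I_(max_visits D v)}.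

Definition orig (v : ext_node) : V := tag v.

Definition ext_arcs : {set ext_node * ext_node} :=
  [set a | (orig a.1, orig a.2) \in arcs D].

Definition ext_pickup : {set ext_node} := [set v | orig v \in pickup D].

(* A drop-off point has exactly one copy, so this is U itself, seen inside the
   extended node set. *)
Definition ext_dropoff : {set ext_node} := [set w | orig w \in dropoff D].

Definition delta_out (S : {set ext_node}) : {set ext_node * ext_node} :=
  [set a in ext_arcs | (a.1 \in S) && (a.2 \notin S)].

Definition delta_in (S : {set ext_node}) : {set ext_node * ext_node} :=
  [set a in ext_arcs | (a.2 \in S) && (a.1 \notin S)].

Definition delta (v : ext_node) : {set ext_node * ext_node} :=
  delta_out [set v] :|: delta_in [set v].

(* Total functions again: x and f matter only on ext_arcs, q only on
   ext_pickup, s and e only on ext_dropoff. *)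
Record dobc_vector := DobcVector {
  xv : ext_node * ext_node -> R;
  yv : ext_node -> R;
  fv : ext_node * ext_node -> R;
  qv : ext_node -> R;
  sv : ext_node -> R;
  ev : ext_node -> R
}.

Definition binary (r : R) : Prop := r = 0 \/ r = 1.

Section Constraints.
Variable z : dobc_vector.
Let x := xv z. Let y := yv z. Let f := fv z.
Let q := qv z. Let s := sv z. Let e := ev z.

Record dobc_domain : Prop := DobcDomain {
  dom_y : forall v, binary (y v);
  dom_x : forall a, a \in ext_arcs -> binary (x a);
  dom_f : forall a, a \in ext_arcs -> 0 <= f a;
  dom_q : forall v, v \in ext_pickup -> 0 <= q v <= 1;
  dom_s : forall w, w \in ext_dropoff -> binary (s w);
  dom_e : forall w, w \in ext_dropoff -> binary (e w)
}.

Record dobc_constraints : Prop := DobcConstraints {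
  C1 : \sum_(w in ext_dropoff) setup_cost D (orig w) * y w <= budget D;
  C2 : forall w, w \in ext_dropoff ->
    \sum_(a in delta w) x a <= (2 * #|ext_pickup|)%:R * y w;
  C3 : forall v, v \in pickup D ->
    \sum_(v' in ext_pickup | orig v' == v) q v' = 1;
  C4 : forall v, v \in ext_pickup -> q v <= y v;
  C5 : forall v, v \in pickup D ->
    1 <= \sum_(v' in ext_pickup | orig v' == v) y v';
  C6 : forall v, v \in ext_pickup -> \sum_(a in delta_out [set v]) x a = y v;
  C7 : forall v, v \in ext_pickup -> \sum_(a in delta_in [set v]) x a = y v;
  C8 : forall v, v \in ext_pickup ->
    \sum_(a in delta_out [set v]) f a - \sum_(a in delta_in [set v]) f a
      = q v * demand D (orig v);
  C9 : forall a, a \in ext_arcs -> f a <= capacity D * x a;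
  C10 : forall w, w \in ext_dropoff ->
    min_amount D * y w <= \sum_(a in delta_in [set w]) f a;
  C11 : forall w, w \in ext_dropoff ->
    \sum_(a in delta_out [set w]) x a - \sum_(a in delta_in [set w]) x a
      = s w - e w;
  C12 : \sum_(w in ext_dropoff) e w <= 1 /\ \sum_(w in ext_dropoff) s w <= 1;
  C13 : \sum_(w in ext_dropoff) e w - \sum_(w in ext_dropoff) s w = 0;
  C14 : forall w, w \in ext_dropoff -> e w + s w <= y w
}.

Definition used_nodes : {set ext_node} := [set v | y v == 1].

Definition used_arcs : {set ext_node * ext_node} :=
  [set a in ext_arcs | x a == 1].

End Constraints.
End ExtendedGraph.

(* Paths have to stay inside the node set N.  The graph without nodes counts as
   connected. *)
Definition weakly_connected (T : finType) (N : {set T}) (E : {set T * T}) :=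
  {in N &, forall u v, connect [rel a b | [&& a \in N, b \in N &
    ((a, b) \in E) || ((b, a) \in E)]] u v}.

(* Main.v *)
Require Import Defs.
From HB Require Import structures.
From mathcomp Require Import all_boot all_order all_algebra.

Set Implicit Arguments.
Unset Strict Implicit.
Unset Printing Implicit Defensive.

Import Order.TTheory GRing.Theory Num.Theory.
Local Open Scope ring_scope.

(** Suppose that a set [S] separates two used nodes and that no used arc
    crosses [S] in either direction.  Every used drop-off point receives a
    positive flow (C10), hence is the head of a used arc, whose tail is a used
    pick-up copy because no arc joins two drop-off points; so there are used
    pick-up copies on both sides ([used_pickup_same_side]).  Since
    nothing leaves [S], the cut inequality for [S] says that the starting
    points outside [S] have total weight at least 1; since nothing leaves the
    complement of [S] either, the cut inequality for the complement says the
    same of the starting points inside [S].  The walk would have two starting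
    points, against (C12). *)

(** Taking for [S] the component of a node reduces connectedness to a
    statement about cuts, which is the language of the model. *)
Lemma weakly_connected_of_cuts (T : finType) (N : {set T}) (E : {set T * T}) :
  {in E, forall a, (a.1 \in N) && (a.2 \in N)} ->
  (forall (S : {set T}) u v, u \in N -> v \in N -> u \in S -> v \notin S ->
     exists2 a, a \in E & (a.1 \in S) != (a.2 \in S)) ->
  weakly_connected N E.
Proof.
move=> endsN cutE u v uN vN; set r := [rel a b | _].
apply/negPn/negP => uv_disc.
have [||[b c] bcE] := cutE [set t | connect r u t] u v uN vN.
- by rewrite inE connect0.
- by rewrite inE.
have /andP[/= bN cN] := endsN _ bcE.
have bc : connect r b c by apply: connect1; rewrite /= bN cN bcE.
have cb : connect r c b by apply: connect1; rewrite /= bN cN bcE orbT.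
rewrite !inE => /eqP[]; apply/idP/idP => /= conn.
- exact: connect_trans conn bc.
- exact: connect_trans conn cb.
Qed.

Lemma ler_sum_elem (R : realFieldType) (I : finType) (A : {set I})
    (F : I -> R) (i : I) :
  {in A, forall j, 0 <= F j} -> i \in A -> F i <= \sum_(j in A) F j.
Proof.
move=> F_ge0 iA; rewrite (bigD1 i) //= lerDl.
by apply: sumr_ge0 => j /andP[jA _]; apply: F_ge0.
Qed.

Section UsedSubnetwork.
Variables (R : realFieldType) (V : finType) (D : dobc_data R V).
Variable z : dobc_vector D.
Hypotheses (hdom : dobc_domain z) (hcons : dobc_constraints z).

Implicit Types (u v w : ext_node D) (S : {set ext_node D}).

Lemma ext_node_pickup_or_dropoff v :
  (v \in ext_pickup D) || (v \in ext_dropoff D).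
Proof.
have : orig v \in pickup D :|: dropoff D by rewrite pickupU_dropoff inE.
by rewrite !inE.
Qed.

Lemma ext_arc_neq a : a \in ext_arcs D -> a.1 != a.2.
Proof.
rewrite inE => aA; apply/eqP => e12.
by move: aA; rewrite e12 (negbTE (arcs_loopless D _)).
Qed.

Lemma ext_arc_delta_out a : a \in ext_arcs D -> a \in delta_out [set a.1].
Proof. by move=> aA; rewrite inE aA !inE eqxx eq_sym ext_arc_neq. Qed.

Lemma ext_arc_delta_in a : a \in ext_arcs D -> a \in delta_in [set a.2].
Proof. by move=> aA; rewrite inE aA !inE eqxx ext_arc_neq. Qed.

Lemma delta_out_arc S a : a \in delta_out S -> a \in ext_arcs D.
Proof. by rewrite inE => /andP[]. Qed.

Lemma delta_in_arc S a : a \in delta_in S -> a \in ext_arcs D.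
Proof. by rewrite inE => /andP[]. Qed.

Lemma xv_ge0 a : a \in ext_arcs D -> 0 <= xv z a.
Proof. by move=> /(dom_x hdom)[] ->; rewrite ?ler01. Qed.

Lemma yv_used v : 0 < yv z v -> v \in used_nodes z.
Proof.
by rewrite inE; case: (dom_y hdom v) => ->; rewrite ?ltxx ?eqxx.
Qed.

Lemma unused_arc_eq0 a :
  a \in ext_arcs D -> a \notin used_arcs z -> xv z a = 0.
Proof.
move=> aA; rewrite inE aA /=.
by case: (dom_x hdom aA) => -> //; rewrite eqxx.
Qed.

(** A used arc makes its endpoints used: through the degree equations (C6) and
    (C7) at a pick-up copy, and through (C2) at a drop-off point. *)
Lemma used_arc_endpoints a :
  a \in used_arcs z -> (a.1 \in used_nodes z) && (a.2 \in used_nodes z).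
Proof.
rewrite inE => /andP[aA /eqP xa].
have dropoff_end v : v \in ext_dropoff D -> a \in delta v ->
    v \in used_nodes z.
  move=> vU av; apply: yv_used.
  have y_ge0 : 0 <= yv z v by case: (dom_y hdom v) => ->; rewrite ?ler01.
  rewrite lt_def y_ge0 andbT; apply/eqP => yv0.
  have x_le : xv z a <= \sum_(b in delta v) xv z b.
    apply: ler_sum_elem av => b.
    by rewrite inE => /orP[/delta_out_arc|/delta_in_arc]; apply: xv_ge0.
  by have := le_trans x_le (C2 hcons vU); rewrite xa yv0 mulr0 ler10.
apply/andP; split.
- have [vP|vU] := orP (ext_node_pickup_or_dropoff a.1).
    apply: yv_used; rewrite -(C6 hcons vP); apply: lt_le_trans ltr01 _.
    rewrite -xa; apply: ler_sum_elem (ext_arc_delta_out aA) => b.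
    by move/delta_out_arc/xv_ge0.
  by apply: dropoff_end => //; rewrite inE ext_arc_delta_out.
- have [vP|vU] := orP (ext_node_pickup_or_dropoff a.2).
    apply: yv_used; rewrite -(C7 hcons vP); apply: lt_le_trans ltr01 _.
    rewrite -xa; apply: ler_sum_elem (ext_arc_delta_in aA) => b.
    by move/delta_in_arc/xv_ge0.
  by apply: dropoff_end => //; rewrite inE ext_arc_delta_in ?orbT.
Qed.

(** The minimum amount [min_amount D] is positive, so some arc entering a used
    drop-off point carries flow, and by (C9) only used arcs do. *)
Lemma used_dropoff_in_arc w :
  w \in ext_dropoff D -> w \in used_nodes z ->
  exists2 a, a \in used_arcs z & a.2 = w.
Proof.
move=> wU; rewrite inE => /eqP yw.
have [/exists_inP[a aE /eqP a2]|no_arc] :=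
    boolP [exists a in used_arcs z, a.2 == w]; first by exists a.
have := C10 hcons wU; rewrite yw mulr1 leNgt => /negP[].
apply: le_lt_trans (min_amount_gt0 D).
apply: sumr_le0 => a; rewrite inE in_set1 => /andP[aA /andP[a2 _]].
have aE : a \notin used_arcs z.
  by apply: contra no_arc => aE; apply/exists_inP; exists a.
by have := C9 hcons aA; rewrite (unused_arc_eq0 aA aE) mulr0.
Qed.

Lemma used_pickup_same_side S u :
  {in used_arcs z, forall a, (a.1 \in S) = (a.2 \in S)} ->
  u \in used_nodes z ->
  exists v, [/\ v \in used_nodes z, v \in ext_pickup D
              & (v \in S) = (u \in S)].
Proof.
move=> uncrossed uN.
have [uP|uU] := orP (ext_node_pickup_or_dropoff u); first by exists u.
have [a aE a2] := used_dropoff_in_arc uU uN.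
have /andP[a1N _] := used_arc_endpoints aE.
exists a.1; split; rewrite ?uncrossed ?a2 //.
have [//|a1U] := orP (ext_node_pickup_or_dropoff a.1).
move: aE; rewrite !inE a2 => /andP[aA _].
rewrite !inE in a1U uU.
by rewrite (negbTE (arcs_no_dropoff2 a1U uU)) in aA.
Qed.

Lemma sum_uncrossed_delta_out S :
  {in used_arcs z, forall a, (a.1 \in S) = (a.2 \in S)} ->
  \sum_(a in delta_out S) xv z a = 0.
Proof.
move=> uncrossed; apply: big1 => a; rewrite inE => /andP[aA /andP[a1 a2]].
apply: unused_arc_eq0 => //; apply/negP => /uncrossed.
by rewrite a1 (negbTE a2).
Qed.

End UsedSubnetwork.

Theorem proposition3p1 (R : realFieldType) (V : finType) (D : dobc_data R V)
  (z : dobc_vector D) (hdom : dobc_domain z) (hcons : dobc_constraints z)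
  (hcut : forall (S : {set ext_node D}) (v v' : ext_node D),
     v \in S :&: ext_pickup D -> v' \in ~: S :&: ext_pickup D ->
     \sum_(a in delta_out S) xv z a >=
       yv z v + yv z v' - 1 - \sum_(w in ~: S :&: ext_dropoff D) sv z w) :
  weakly_connected (used_nodes z) (used_arcs z).
Proof.
apply: weakly_connected_of_cuts => [a|S u u' uN u'N uS u'S].
  exact: used_arc_endpoints.
have [/exists_inP[a aE aS]|no_arc] :=
    boolP [exists a in used_arcs z, (a.1 \in S) != (a.2 \in S)].
  by exists a.
have uncrossed : {in used_arcs z, forall a, (a.1 \in S) = (a.2 \in S)}.
  move=> a aE; apply/eqP; apply: contraR no_arc => aS.
  by apply/exists_inP; exists a.
have [v [vN vP vS]] := used_pickup_same_side hdom hcons uncrossed uN.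
have [v' [v'N v'P v'S]] := used_pickup_same_side hdom hcons uncrossed u'N.
rewrite uS in vS; rewrite (negbTE u'S) in v'S.
have start_outside (T : {set ext_node D}) t t' :
    {in used_arcs z, forall a, (a.1 \in T) = (a.2 \in T)} ->
    t \in T -> t' \notin T ->
    t \in used_nodes z -> t' \in used_nodes z ->
    t \in ext_pickup D -> t' \in ext_pickup D ->
    1 <= \sum_(w in ~: T :&: ext_dropoff D) sv z w.
  move=> uncT tT t'T; rewrite !(in_set (fun v => _ == 1)).
  move=> /eqP yt /eqP yt' tP t'P.
  have := @hcut T t t'; rewrite !in_setI in_setC tT t'T tP t'P.
  rewrite sum_uncrossed_delta_out // yt yt' addrK subr_le0.
  by apply.
have s_out := start_outside S v v' uncrossed vS (negbT v'S) vN v'N vP v'P.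
have s_in : 1 <= \sum_(w in S :&: ext_dropoff D) sv z w.
  rewrite -[X in X :&: _]setCK; apply: (start_outside _ v' v) => //.
  - by move=> a aE; rewrite !in_setC uncrossed.
  - by rewrite in_setC v'S.
  - by rewrite in_setC vS.
have [_] := C12 hcons; rewrite (big_setID S) /= setIC setDE [_ :&: ~: _]setIC.
by move/(le_trans (lerD s_in s_out)); rewrite gerDl ler10.
Qed.
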